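(* In the M/G/$\infty$ polling system with $N\geqslant 2$ queues visited in the fixed cyclic order $1,2,\ldots,N$ described in the context, in steady state, let $X_i^j$ be the number of customers in queue $j$ at a polling instant of queue $i$, and let $D=\sum_{i=1}^N D_i$, $p_j=\mathbb{P}[B_j\leqslant V_j]$ and $\Lambda_j(t)=\lambda_j\int_0^t\mathbb{P}[B_j>y]\,\mathrm{d}y$. Then, for every $j\in\{1,\ldots,N\}$, $$p_j\,\mathbb{E}[X_j^j]=\lambda_j\sum_{i\neq j}\mathbb{E}[V_i]+\mathbb{E}[\Lambda_j(V_j)]+\lambda_j\mathbb{E}[D],$$ and for every $i\neq j$, with queue indices taken cyclically modulo $N$ so that $i\in\{j+1,\ldots,j+N-1\}$, $$\mathbb{E}[X_i^j]=(1-p_j)\,\mathbb{E}[X_j^j]+\mathbb{E}[\Lambda_j(V_j)]+\lambda_j\sum_{k=j+1}^{i-1}\mathbb{E}[V_k]+\lambda_j\sum_{k=j}^{i-1}\mathbb{E}[D_k].$$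
   Context: The system has $N\geqslant2$ infinite-buffer queues attended in cyclic order by a single group of infinitely many servers moving together. The polling instant of queue $i$ is the moment when the servers enter queue $i$. Customers arrive at queue $i$ according to a Poisson process with rate $\lambda_i$; the arrival processes are independent. The servers stay at queue $i$ for a random visit time $V_i$, during which queue $i$ works as an M/G/$\infty$ queue: customers present at the polling instant start service at that moment and customers arriving during the visit start service on arrival. Service times at queue $i$ are i.i.d. copies of $B_i$; customers completing service leave the system; a customer whose service is not completed by the end of the visit stays and receives at the next visit a fresh independent service time distributed as $B_i$. After the visit to queue $i$ the servers need a switch-over time $D_i$ before entering queue $i+1$. All arrival processes, visit times, service times and switch-over times are mutually independent, and $\mathbb{E}[V_i],\mathbb{E}[D_i]<\infty$. The evolution between consecutive polling instants is given by the law of motion $$X_{i+1}^j=\begin{cases}X_i^j+A_{j,1}(V_i)+A_{j,2}(D_i), & j\neq i,\\ \mathrm{Binom}(X_i^i,1-p_i(V_i))+\mathrm{Poisson}(\Lambda_i(V_i))+A_{i,2}(D_i), & j=i,\end{cases}$$ where $p_i(t)=\mathbb{P}[B_i\leqslant t]$, $(X_i^1,\ldots,X_i^N)$, $V_i$ and $D_i$ are independent and, given these, all the displayed variables are independent, with $A_{j,k}(t)$ Poisson distributed with mean $\lambda_j t$, $\mathrm{Binom}(m,q)$ binomial with parameters $m$ and $q$, and $\mathrm{Poisson}(a)$ Poisson distributed with mean $a$. Steady state means that the law of $(X_i^1,\ldots,X_i^N)$ is the same in every cycle, so that the law of motion holds in distribution for all $i$ with indices modulo $N$ ($X_{N+1}^j$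 has the law of $X_1^j$); the means $\mathbb{E}[X_i^j]$ are assumed finite. *)

(* Defs.v *)
From HB Require Import structures.
From mathcomp Require Import all_boot all_order all_algebra.
From mathcomp Require Import all_classical all_reals all_analysis.

Set Implicit Arguments.
Unset Strict Implicit.
Unset Printing Implicit Defensive.

Import Order.TTheory GRing.Theory Num.Theory.
Import numFieldNormedType.Exports.

Local Open Scope classical_set_scope.
Local Open Scope ring_scope.
Local Open Scope ereal_scope.

(* Queues are numbered 0, ..., N - 1; [queue hN k] is the queue with index k
   taken modulo N. *)
Definition queue (N : nat) (hN : (1 < N)%N) (k : nat) : 'I_N :=
  Ordinal (ltn_pmod k (ltnW hN)).

(* The family is indexed by a finite type, so the product rule for the whole
   family yields it for every subfamily, by taking the other A k to be setT. *)
Definition mutually_independent (R : realType) (d : measure_display)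
    (T : measurableType d) (P : probability T R) (I : finType)
    (Y : I -> T -> R) : Prop :=
  forall A : I -> set R, (forall k, measurable (A k)) ->
    P [set w | forall k, A k (Y k w)] = \prod_(k : I) P (Y k @^-1` A k).

Section polling.
Context (R : realType) (d : measure_display) (T : measurableType d)
  (P : probability T R) (N : nat).

Definition service_prob (B : 'I_N -> {RV P >-> R}) (i : 'I_N) (t : R) : R :=
  fine (cdf (B i) t).

Definition Lambda (lambda : 'I_N -> R) (B : 'I_N -> {RV P >-> R})
    (i : 'I_N) (t : R) : R :=
  (lambda i * \int[lebesgue_measure]_(y in `[0, t]) fine (ccdf (B i) y))%R.

Definition time_family (V D B : 'I_N -> {RV P >-> R})
    (k : 'I_N + 'I_N + 'I_N) : T -> R :=
  match k with
  | inl (inl i) => V i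
  | inl (inr i) => D i
  | inr i => B i
  end.

Definition queue_lengths (X : 'I_N -> 'I_N -> {RV P >-> nat}) (i : 'I_N)
    (w : T) : N.-tuple nat :=
  [tuple X i j w | j < N].

(* Right-hand side of the law of motion from queue i to the next queue:
   A1 i j (relevant for j != i) and A2 i j are the numbers of arrivals at
   queue j during the visit to queue i and during the following switch-over;
   S i and L i are the numbers of customers of queue i who were present at the
   polling instant, resp. arrived during the visit, and are still there at the
   end of the visit. *)
Definition next_queue_lengths (X A1 A2 : 'I_N -> 'I_N -> {RV P >-> nat})
    (S L : 'I_N -> {RV P >-> nat}) (i : 'I_N) (w : T) : N.-tuple nat :=
  [tuple (if j == i then S i w + L i w + A2 i j w
          else X i j w + A1 i j w + A2 i j w)%N | j < N].

(* Given the sigma-algebra generated by (X_i^1, ..., X_i^N), V_i and D_i, the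
   variables S i, L i, A1 i j (j != i) and A2 i j are independent with the
   displayed binomial and Poisson laws.  [poisson_prob] is used rather than
   [poisson_pmf] because the mean may vanish: [poisson_prob 0 _] is the Dirac
   mass at 0, whereas [poisson_pmf 0 _] is constantly 1.  The second argument
   of [poisson_prob] is a dummy. *)
Definition conditional_laws (lambda : 'I_N -> R)
    (V D B : 'I_N -> {RV P >-> R}) (X A1 A2 : 'I_N -> 'I_N -> {RV P >-> nat})
    (S L : 'I_N -> {RV P >-> nat}) (i : 'I_N) : Prop :=
  forall (C : set (N.-tuple nat * R * R)) (s l : nat) (a1 a2 : 'I_N -> nat),
    measurable C ->
    let E := [set w | C (queue_lengths X i w, V i w, D i w)] in
    P (E `&` [set w | [/\ S i w = s, L i w = l,
                          forall j, j != i -> A1 i j w = a1 j &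
                          forall j, A2 i j w = a2 j]]) =
    \int[P]_(w in E)
      (binomial_prob (X i i w) (1 - service_prob B i (V i w))%R [set s] *
       poisson_prob (Lambda lambda B i (V i w)) 0%N [set l] *
       (\prod_(j < N | j != i)
          poisson_prob (lambda j * V i w)%R 0%N [set a1 j]) *
       (\prod_(j < N) poisson_prob (lambda j * D i w)%R 0%N [set a2 j])).

Record steady_state_polling (hN : (1 < N)%N) (lambda : 'I_N -> R)
    (V D B : 'I_N -> {RV P >-> R}) (X A1 A2 : 'I_N -> 'I_N -> {RV P >-> nat})
    (S L : 'I_N -> {RV P >-> nat}) : Prop := {
  rate_ge0 : forall i, (0 <= lambda i)%R ;
  visit_ge0 : forall i w, (0 <= V i w)%R ;
  switch_ge0 : forall i w, (0 <= D i w)%R ;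
  service_ge0 : forall i w, (0 <= B i w)%R ;
  visit_mean_fin : forall i, 'E_P[V i] < +oo ;
  switch_mean_fin : forall i, 'E_P[D i] < +oo ;
  queue_mean_fin : forall i j, 'E_P[fun w => (X i j w)%:R] < +oo ;
  times_indep : mutually_independent P (time_family V D B) ;
  state_indep : forall i (C : set (N.-tuple nat)) (G H : set R),
    measurable C -> measurable G -> measurable H ->
    P (queue_lengths X i @^-1` C `&` V i @^-1` G `&` D i @^-1` H) =
    P (queue_lengths X i @^-1` C) * P (V i @^-1` G) * P (D i @^-1` H) ;
  transition_laws : forall i, conditional_laws lambda V D B X A1 A2 S L i ;
  (* equality in distribution only, and the successor of queue N - 1 is
     queue 0: this is stationarity over a cycle *)
  law_of_motion : forall (i : 'I_N) (C : set (N.-tuple nat)), measurable C ->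
    P (queue_lengths X (queue hN i.+1) @^-1` C) =
    P (next_queue_lengths X A1 A2 S L i @^-1` C)
}.

End polling.

(* Main.v *)
Require Import Defs.
From HB Require Import structures.
From mathcomp Require Import all_boot all_order all_algebra.
From mathcomp Require Import all_classical all_reals all_analysis.
From mathcomp Require Import measurable_realfun ring lra.

Set Implicit Arguments.
Unset Strict Implicit.
Unset Printing Implicit Defensive.

Import Order.TTheory GRing.Theory Num.Theory.
Import numFieldNormedType.Exports.

Local Open Scope classical_set_scope.
Local Open Scope ring_scope.
Local Open Scope ereal_scope.

(* Only means are propagated. Conditionally on the state and on the times, the
   survivors of queue i have mean X_i^i (1 - p_i(V_i)) and the Poisson variables
   have means Lambda_i(V_i), lambda_j V_i and lambda_j D_i; as X_i^i, V_i and B_i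
   are independent, E[p_i(V_i)] = P[B_i <= V_i] and the first mean factorises.
   Hence E[X_i^j] grows by lambda_j (E[V_i] + E[D_i]) when the servers leave a
   queue i <> j, and becomes
   (1 - p_j) E[X_j^j] + E[Lambda_j(V_j)] + lambda_j E[D_j] when they leave j.
   Iterating from j gives the second formula, and closing the cycle at j + N
   gives the first. *)

(** * Means of the Poisson and binomial laws *)

Section distributions_on_nat.
Context (R : realType).

Lemma nneseries_probability_set1 (Q : probability nat R) :
  \sum_(n <oo) Q [set n] = 1.
Proof.
rewrite -(@probability_setT _ _ _ Q) -(_ : \bigcup_(n in setT) [set n] = setT).
  rewrite measure_bigcup//; first by apply: eq_eseriesl => n; rewrite in_setT.
  by move=> i j _ _ [n [/= -> ->]].
by apply/seteqP; split => // n _; exists n.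
Qed.

Lemma poisson_prob_set1 (a : R) k n : (0 < a)%R ->
  poisson_prob a k [set n] = (poisson_pmf a n)%:E.
Proof.
by move=> a0; rewrite /poisson_prob a0 esum_set1// lee_fin poisson_pmf_ge0.
Qed.

(** For [a > 0], weighting by [n] shifts the law: [n] times the mass at [n] is [a] times the mass at
    [n - 1], and these masses sum to 1. *)
Lemma poisson_mean (a : R) k : (0 <= a)%R ->
  \sum_(n <oo) n%:R%:E * poisson_prob a k [set n] = a%:E.
Proof.
(* Zero mean is apart: the law is then the Dirac mass at 0, so every term vanishes. *)
rewrite le_eqVlt => /predU1P[<-|a0].
  rewrite eseries0// => -[|n] _ _; first by rewrite mul0e.
  by rewrite /poisson_prob ltxx diracE memNset ?mule0.
under eq_eseriesr do rewrite poisson_prob_set1//.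
have p0 n : 0 <= n%:R%:E * (poisson_pmf a n)%:E.
  by rewrite mule_ge0// lee_fin ?ler0n ?poisson_pmf_ge0.
rewrite nneseries_recl// mul0e add0e -(nneseries_addn 1)//=.
have step n : (n + 1)%:R%:E * (poisson_pmf a (n + 1))%:E =
    a%:E * poisson_prob a k [set n].
  rewrite poisson_prob_set1// -!EFinM; congr EFin.
  rewrite /poisson_pmf a0 addn1 factS natrM exprS.
  by field; rewrite pnatr_eq0 -lt0n fact_gt0/= nat1r pnatr_eq0.
under eq_eseriesr do rewrite step.
by rewrite nneseriesZl ?nneseries_probability_set1 ?mule1.
Qed.

(** Absorption, [n * 'C(m, n) = m * 'C(m - 1, n - 1)], extracts the factor [m * q]; the binomial
    theorem sums the rest to 1. *)
Lemma binomial_mean (m : nat) (q : R) : (0 <= q <= 1)%R ->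
  \sum_(n <oo) n%:R%:E * binomial_prob m q [set n] = (m%:R * q)%:E.
Proof.
move=> q01.
have pmfE n : binomial_prob m q [set n] = (binomial_pmf m q n)%:E.
  by rewrite /binomial_prob q01 esum_set1// lee_fin binomial_pmf_ge0.
under eq_eseriesr do rewrite pmfE.
(* The series is a finite sum, since ['C(m, n)] vanishes for [n > m]. *)
rewrite (nneseries_split 0 m.+1); last first.
  by move=> n _; rewrite mule_ge0// lee_fin ?ler0n ?binomial_pmf_ge0.
rewrite [X in _ + X]eseries0 ?adde0; last first.
  by move=> n mn _; rewrite /binomial_pmf bin_small// mulr0n mule0.
rewrite add0n.
under eq_bigr do rewrite -EFinM.
rewrite sumEFin; congr EFin.
rewrite big_nat_recl// mul0r add0r.
case: m {pmfE} => [|m]; first by rewrite big_geq// mul0r.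
have step i : (i.+1%:R * binomial_pmf m.+1 q i.+1 =
    m.+1%:R * q * ((1 - q) ^+ (m - i) * q ^+ i *+ 'C(m, i)))%R.
  rewrite /binomial_pmf subSS -mulrnAr -mulr_natr -[in RHS]mulr_natr.
  rewrite -[in LHS]mulr_natr.
  have /(congr1 (fun n => n%:R : R)) := mul_bin_diag m.+1 i.
  rewrite !natrM/= => e.
  rewrite [RHS](_ : _ = m.+1%:R * 'C(m, i)%:R *
    (q * (1 - q) ^+ (m - i) * q ^+ i))%R; last by ring.
  by rewrite e exprS; ring.
under eq_bigr do rewrite step.
rewrite -mulr_sumr big_mkord -exprDn_comm; last exact: mulrC.
by rewrite subrK expr1n mulr1.
Qed.

End distributions_on_nat.

(** * Expectations through laws, mixtures and independence *)

Section probability_facts.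
Context d (T : measurableType d) (R : realType) (P : probability T R).

Lemma measurable_natr (D : set T) (Y : T -> nat) : measurable_fun D Y ->
  measurable_fun D (fun w => (Y w)%:R : R).
Proof.
exact: (@measurableT_comp _ _ _ _ _ _ (fun n : nat => n%:R : R)).
Qed.

Lemma expectation_nat_series (Y : T -> nat) : measurable_fun setT Y ->
  'E_P[fun w => (Y w)%:R] = \sum_(n <oo) n%:R%:E * P (Y @^-1` [set n]).
Proof.
move=> mY; rewrite unlock.
have mYn n : measurable (Y @^-1` [set n]).
  by rewrite -[X in measurable X]setTI; exact: mY.
(* The level sets of [Y] partition the space, and the integrand is constant on each. *)
have <- : \bigcup_n (Y @^-1` [set n]) = setT.
  by apply/seteqP; split => // w _; exists (Y w).
rewrite ge0_integral_bigcup//=.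
- apply: eq_eseriesr => n _.
  rewrite (eq_integral (cst n%:R%:E)); first by rewrite integral_cst.
  by move=> w /set_mem/= ->.
- by apply/measurable_EFinP/measurable_natr; exact: measurable_funTS.
- by move=> i j _ _ [w [/= <- <-]].
Qed.

Lemma expectation_natD (f g : T -> nat) :
  measurable_fun setT f -> measurable_fun setT g ->
  'E_P[fun w => (f w + g w)%:R] =
  'E_P[fun w => (f w)%:R] + 'E_P[fun w => (g w)%:R].
Proof.
move=> mf mg; rewrite unlock -ge0_integralD//.
- by apply: eq_integral => w _; rewrite natrD EFinD.
- by apply/measurable_EFinP/measurable_natr.
- by apply/measurable_EFinP/measurable_natr.
Qed.

(* K w is the conditional law of Y given w *)
Lemma expectation_mixture (Y : T -> nat) (K : T -> nat -> \bar R) :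
  measurable_fun setT Y ->
  (forall n, measurable_fun setT (K ^~ n)) -> (forall w n, 0 <= K w n) ->
  (forall n, P (Y @^-1` [set n]) = \int[P]_w K w n) ->
  'E_P[fun w => (Y w)%:R] = \int[P]_w \sum_(n <oo) n%:R%:E * K w n.
Proof.
move=> mY mK K0 YK; rewrite expectation_nat_series// integral_nneseries//.
- by apply: eq_eseriesr => n _; rewrite YK ge0_integralZl ?lee_fin.
- by move=> n; exact: measurable_funeM.
- by move=> n w _; rewrite mule_ge0// lee_fin.
Qed.

Lemma measurable_RV_le (U W : {RV P >-> R}) :
  measurable [set w | (U w <= W w)%R].
Proof.
rewrite -[X in measurable X]setTI.
exact: (measurable_fun_ler (f := U) (g := W)).
Qed.

(** The product rule on rectangles identifies the joint law with the product of the marginal laws,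
    by uniqueness of the product measure; Tonelli then splits the integral. *)
Lemma ge0_integral_indep d1 d2 (T1 : measurableType d1) (T2 : measurableType d2)
    (X : {RV P >-> T1}) (Y : {RV P >-> T2}) (f : T1 * T2 -> \bar R) :
  (forall A B, measurable A -> measurable B ->
    P (X @^-1` A `&` Y @^-1` B) = P (X @^-1` A) * P (Y @^-1` B)) ->
  measurable_fun setT f -> (forall z, 0 <= f z) ->
  \int[P]_w f (X w, Y w) = \int[P]_w \int[P]_v f (X w, Y v).
Proof.
move=> indep mf f0.
have mXY : measurable_fun setT (fun w => (X w, Y w)).
  exact: measurable_fun_pair.
pose XY : {RV P >-> (T1 * T2)%type} :=
  HB.pack (fun w => (X w, Y w)) (isMeasurableFun.Build _ _ _ _ _ mXY).
rewrite -(ge0_integral_distribution XY)//.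
have XYE A : measurable A ->
    (distribution P X \x distribution P Y) A = distribution P XY A.
  by apply: product_measure_unique => C D mC mD; exact: indep.
rewrite (eq_measure_integral
  (distribution P X \x distribution P Y)); last first.
  by move=> A mA _; apply/esym; exact: XYE.
rewrite fubini_tonelli1//.
rewrite (ge0_integral_distribution X)//=.
- apply: eq_integral => w _; rewrite /fubini_F (ge0_integral_distribution Y)//.
  exact: measurableT_comp (pair1_measurable _).
- exact: measurable_fun_fubini_tonelli_F.
- by move=> x; apply: integral_ge0.
Qed.

End probability_facts.

(** * Marginals of conditional product laws and measurability of the kernels *)

Section conditional_law_marginals.
Context d (T : measurableType d) (R : realType) (P : probability T R).

(* The factors are summed out one index at a time. *)
Lemma marginal_law (I : finType) (Y : I -> T -> nat)
    (K : I -> T -> probability nat R) (J : {set I}) :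
  (forall k, measurable_fun setT (Y k)) ->
  (forall k n, measurable_fun setT (fun w => K k w [set n])) ->
  (forall a : I -> nat, P [set w | forall k, k \in J -> Y k w = a k] =
    \int[P]_w \prod_(k in J) K k w [set a k]) ->
  forall k n, k \in J -> P (Y k @^-1` [set n]) = \int[P]_w K k w [set n].
Proof.
move=> mY mK; have [m] := ubnP #|J|; elim: m J => // m IH J Jm JK k n kJ.
(* Either some index [l] other than [k] remains to be summed out, or [J] is the singleton of [k] and
   the hypothesis is already the claim. *)
have [/existsP[l /andP[lJ lk]]|/existsPn noJ] :=
  boolP [exists l, (l \in J) && (l != k)]; last first.
  have {}noJ l : (l \in J) = (l == k).
    apply/idP/eqP => [lJ|->//]; apply/eqP.
    by have := noJ l; rewrite lJ/= negbK.
  have := JK (fun=> n).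
  rewrite (_ : [set w | _] = Y k @^-1` [set n]); last first.
    apply/seteqP; split => w /=; first exact.
    by move=> Yn l; rewrite noJ => /eqP ->.
  move=> ->; apply: eq_integral => w _.
  by rewrite (eq_bigl _ _ noJ) big_pred1_eq.
apply: (IH (J :\ l)%SET) => //; last by rewrite !inE eq_sym lk.
  by move: Jm; rewrite (cardsD1 l) lJ.
move=> a.
(* [a' m] prescribes the value [m] at [l] and agrees with [a] elsewhere; the disjoint events [E m]
   exhaust the event in which [Y l] is left free. *)
pose a' m (i : I) := if i == l then m else a i.
pose E m := [set w | forall k, k \in J -> Y k w = a' m k].
have mE i : measurable (E i).
  rewrite (_ : E i =
    \bigcap_(k in [set k | k \in J]) (Y k @^-1` [set a' i k]))//.
  apply: fin_bigcap_measurable => // x _.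
  by rewrite -[X in measurable X]setTI; exact: mY.
have prodE i w : \prod_(k in J) K k w [set a' i k] =
    (\prod_(k in (J :\ l)%SET) K k w [set a k]) * K l w [set i].
  rewrite (big_setD1 l)//= {1}/a' eqxx muleC; congr (_ * _).
  by apply: eq_bigr => x; rewrite !inE => /andP[xl _]; rewrite /a' (negbTE xl).
have prod_fin w : \prod_(k in (J :\ l)%SET) K k w [set a k] \is a fin_num.
  by elim/big_ind : _ => // [x y|x _]; [exact: fin_numM|exact: fin_num_measure].
have mprod i : measurable_fun setT (fun w => \prod_(k in J) K k w [set a' i k]).
  elim: (index_enum I) => [|x s IHs].
    by under eq_fun do rewrite big_nil; exact: measurable_cst.
  under eq_fun do rewrite big_cons.
  by case: (x \in J) => //; exact: emeasurable_funM.
have -> : [set w | forall k, k \in (J :\ l)%SET -> Y k w = a k] = \bigcup_i E i.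
  apply/seteqP; split => w /=.
    move=> Ya; exists (Y l w) => // x xJ; rewrite /a'.
    by case: eqVneq => [->//|xl]; apply: Ya; rewrite !inE xl.
  move=> [i _ Ei] x; rewrite !inE => /andP[xl xJ].
  by rewrite (Ei x xJ) /a' (negbTE xl).
rewrite measure_bigcup//; last first.
  move=> i j _ _ [w [/= /(_ _ lJ) + /(_ _ lJ)]].
  by rewrite /a' eqxx => -> ->.
rewrite (eq_eseriesl (Q := xpredT)); last by move=> i; rewrite in_setT.
rewrite (eq_eseriesr (fun i _ => JK (a' i))).
rewrite -integral_nneseries//.
- apply: eq_integral => w _.
  (* Only the factor at [l] depends on the summation index, and its masses sum to 1; the other
     factors come out as a finite scalar. *)
  under eq_eseriesr do rewrite prodE.
  rewrite -[in RHS](fineK (prod_fin w)) -(fineK (prod_fin w)).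
  by rewrite nneseriesZl// nneseries_probability_set1 mule1.
- by move=> i w _; apply: prode_ge0.
Qed.

(** On each of the countably many measurable level sets of [Y], the function coincides with a single
    [f n]. *)
Lemma measurable_fun_nat_param (Y : T -> nat) (f : nat -> T -> \bar R) :
  measurable_fun setT Y -> (forall n, measurable_fun setT (f n)) ->
  measurable_fun setT (fun w => f (Y w) w).
Proof.
move=> mY mf.
have <- : \bigcup_n (Y @^-1` [set n]) = setT.
  by apply/seteqP; split => // w _; exists (Y w).
have mYn n : measurable (Y @^-1` [set n]).
  by rewrite -[X in measurable X]setTI; exact: mY.
apply/measurable_fun_bigcup => // n.
apply: (eq_measurable_fun (f n)); last exact: measurable_funTS.
by move=> w /set_mem /= ->.
Qed.

Lemma measurable_binomial_prob_set1 (Y : T -> nat) (q : T -> R) n :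
  measurable_fun setT Y -> measurable_fun setT q ->
  (forall w, (0 <= q w <= 1)%R) ->
  measurable_fun setT (fun w => binomial_prob (Y w) (q w) [set n]).
Proof.
move=> mY mq q01.
apply: (eq_measurable_fun (fun w => (binomial_pmf (Y w) (q w) n)%:E)).
  move=> w _; rewrite /binomial_prob q01 esum_set1//.
  by rewrite lee_fin binomial_pmf_ge0.
apply: (measurable_fun_nat_param
  (f := fun m w => (binomial_pmf m (q w) n)%:E)) => // m.
apply/measurable_EFinP.
exact: (measurableT_comp (measurable_binomial_pmf (D := setT) m n) mq).
Qed.

Lemma measurable_poisson_prob_set1 (a : T -> R) k n :
  measurable_fun setT a ->
  measurable_fun setT (fun w => poisson_prob (a w) k [set n]).
Proof.
move=> ma.
(* The sign of the mean is tested explicitly because [poisson_prob] is the Dirac mass at 0 when the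
   mean is not positive. *)
apply: (eq_measurable_fun (fun w =>
    if (0 < a w)%R then (poisson_pmf (a w) n)%:E else \d_0%N [set n])).
  move=> w _; case: ifPn => a0; first by rewrite poisson_prob_set1.
  by rewrite /poisson_prob (negbTE a0).
apply: measurable_fun_ifT => //; first exact: measurable_fun_ltr.
apply/measurable_EFinP.
exact: (measurableT_comp (measurable_poisson_pmf n measurableT) ma).
Qed.

End conditional_law_marginals.

(** * Bounds and measurability for the service probability and [Lambda] *)

Section polling_parameters.
Context (R : realType) (d : measure_display) (T : measurableType d)
  (P : probability T R) (N : nat).
Implicit Types (lambda : 'I_N -> R) (V B : 'I_N -> {RV P >-> R}).

Lemma service_prob_itv B i t : (0 <= service_prob B i t <= 1)%R.
Proof.
rewrite /service_prob fine_ge0//= -lee_fin fineK ?cdf_le1//.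
exact: fin_num_measure.
Qed.

Lemma measurable_service_prob B i : measurable_fun setT (service_prob B i).
Proof. exact: measurableT_comp (cdf_measurable _). Qed.

Lemma integral_ccdf_le B i (t : R) : (0 <= t)%R ->
  \int[lebesgue_measure]_(y in `[0%R, t]) (fine (ccdf (B i) y))%:E <= t%:E.
Proof.
move=> t0.
have -> : t%:E = \int[lebesgue_measure]_(y in `[0%R, t]) (cst 1 y).
  rewrite integral_cst//= mul1e lebesgue_measure_itv/= lte_fin sube0.
  by case: ltgtP t0 => // <-.
apply: ge0_le_integral => //.
- by move=> y _; rewrite lee_fin fine_ge0.
- apply/measurable_EFinP/measurable_funTS.
  exact: measurableT_comp (ccdf_measurable _).
- by move=> y _; rewrite fineK ?fin_num_measure// probability_le1.
Qed.

Lemma Lambda_ge0 lambda B i t : (0 <= lambda i)%R ->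
  (0 <= Lambda lambda B i t)%R.
Proof.
by move=> l0; rewrite mulr_ge0// Rintegral_ge0// => y _; exact: fine_ge0.
Qed.

(** No sign condition on [t]: the interval is empty for [t < 0]. The monotonicity argument for
    [Lambda] compares arbitrary reals. *)
Lemma integral_ccdf_fin_num B i (t : R) :
  \int[lebesgue_measure]_(y in `[0%R, t]) (fine (ccdf (B i) y))%:E
    \is a fin_num.
Proof.
rewrite ge0_fin_numE; last first.
  by apply: integral_ge0 => y _; rewrite lee_fin fine_ge0.
have [t0|t0] := leP 0%R t.
  by rewrite (le_lt_trans (integral_ccdf_le B i t0))// ltry.
by rewrite set_itv_ge -?leNgt/= ?bnd_simp -?ltNge// integral_set0.
Qed.

Lemma Lambda_le lambda B i t : (0 <= lambda i)%R -> (0 <= t)%R ->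
  (Lambda lambda B i t <= lambda i * t)%R.
Proof.
move=> l0 t0; rewrite ler_wpM2l// -lee_fin fineK ?integral_ccdf_fin_num//.
exact: integral_ccdf_le.
Qed.

(** A nonnegative function is integrated over an interval growing with [t], so [Lambda] is
    nondecreasing, hence measurable. *)
Lemma measurable_Lambda lambda B i : (0 <= lambda i)%R ->
  measurable_fun setT (Lambda lambda B i).
Proof.
move=> l0; apply: nondecreasing_measurable => // s t st.
rewrite ler_wpM2l// fine_le ?integral_ccdf_fin_num//.
apply: ge0_subset_integral => //.
- apply/measurable_EFinP/measurable_funTS.
  exact: measurableT_comp (ccdf_measurable _).
- by move=> y _; rewrite lee_fin fine_ge0.
- by apply: subset_itvl; rewrite bnd_simp.
Qed.

End polling_parameters.

(** * Independence and mean service probability in the polling system *)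

Section polling_means.
Context (R : realType) (d : measure_display) (T : measurableType d)
  (P : probability T R) (N : nat) (hN : (1 < N)%N) (lambda : 'I_N -> R)
  (V D B : 'I_N -> {RV P >-> R}) (X A1 A2 : 'I_N -> 'I_N -> {RV P >-> nat})
  (S L : 'I_N -> {RV P >-> nat})
  (hsys : steady_state_polling hN lambda V D B X A1 A2 S L).

Lemma visit_service_indep i (G H : set R) : measurable G -> measurable H ->
  P (V i @^-1` G `&` B i @^-1` H) = P (V i @^-1` G) * P (B i @^-1` H).
Proof.
move=> mG mH.
(* Every variable other than [V i] and [B i] is left unconstrained, so its factor in the product
   rule is 1. *)
pose A (k : 'I_N + 'I_N + 'I_N) : set R := match k with
  | inl (inl i') => if i' == i then G else setT
  | inl (inr _) => setT
  | inr i' => if i' == i then H else setT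
  end.
have mA k : measurable (A k) by case: k => [[k|k]|k] //=; case: ifP.
have := times_indep hsys mA.
rewrite !big_sumType/= (bigD1 i)//= eqxx big1 ?mule1; last first.
  by move=> k /negbTE ->; rewrite preimage_setT probability_setT.
rewrite big1 ?mule1; last by move=> k _; rewrite preimage_setT probability_setT.
rewrite (bigD1 i)//= eqxx big1 ?mule1; last first.
  by move=> k /negbTE ->; rewrite preimage_setT probability_setT.
move=> <-; congr (P _); apply/seteqP; split => w /=.
  by move=> [Gw Hw] [[k|k]|k] //=; case: eqP => // ->.
by move=> Aw; split;
  [have := Aw (inl (inl i))|have := Aw (inr i)]; rewrite /= eqxx.
Qed.

Lemma queue_visit_indep i (C : set nat) (G : set R) :
  measurable C -> measurable G ->
  P (X i i @^-1` C `&` V i @^-1` G) = P (X i i @^-1` C) * P (V i @^-1` G).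
Proof.
move=> mC mG.
have mC' : measurable [set t : N.-tuple nat | C (tnth t i)].
  rewrite -[X in measurable X]setTI.
  exact: (measurable_tnth i).
have := state_indep hsys i mC' mG measurableT.
rewrite preimage_setT setIT probability_setT mule1.
have -> // : queue_lengths X i @^-1` [set t | C (tnth t i)] = X i i @^-1` C.
by apply/seteqP; split => w /=; rewrite tnth_mktuple.
Qed.

(** By independence, the indicator of [B i <= V i] may be integrated first over the service time
    with the visit time fixed; this inner integral is the distribution function of [B i] at
    [V i]. *)
Lemma mean_service_prob i :
  \int[P]_w (service_prob B i (V i w))%:E = P [set w | (B i w <= V i w)%R].
Proof.
pose U := [set z : R * R | (z.2 <= z.1)%R].
have mU : measurable U.
  rewrite -[X in measurable X]setTI.
  exact: (measurable_fun_ler (f := snd) (g := fst)).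
have mUVB := measurable_RV_le (B i) (V i).
have := @ge0_integral_indep _ _ _ P _ _ _ _ (V i) (B i) (fun z => (\1_U z)%:E).
move=> /(_ (@visit_service_indep i)) h.
have {}h := h _ _.
transitivity (\int[P]_w \int[P]_v (\1_U (V i w, B i v))%:E).
  apply: eq_integral => w _; rewrite /service_prob fineK ?fin_num_measure//.
  rewrite (_ : (fun v => _) =
      (fun v => (\1_(B i @^-1` `]-oo, V i w]) v)%:E)).
    rewrite integral_indic ?setIT//.
    rewrite -[X in measurable X]setTI.
    exact: measurable_funP.
  by apply/funext => v; rewrite !indicE; congr (_%:R%:E); apply/idP/idP;
    rewrite !inE /U/= in_itv.
rewrite -h.
- rewrite (_ : (fun w => _) =
    (fun w => (\1_[set w | (B i w <= V i w)%R] w)%:E)).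
    by rewrite integral_indic ?setIT.
  by apply/funext => v; rewrite !indicE; congr (_%:R%:E); apply/idP/idP;
    rewrite !inE.
- by apply/measurable_EFinP; exact: measurable_indic.
- by move=> z; rewrite lee_fin.
Qed.

Lemma mean_survival_prob i :
  \int[P]_w (1 - service_prob B i (V i w))%:E =
  1 - P [set w | (B i w <= V i w)%R].
Proof.
have m1 : measurable_fun setT (fun w => service_prob B i (V i w)).
  exact: measurableT_comp (measurable_service_prob _ _) _.
have s01 w := service_prob_itv B i (V i w).
rewrite -mean_service_prob.
(* The two integrals add up to 1, and the second is finite, so it cancels in the extended reals. *)
have -> : 1 = \int[P]_w (1 - service_prob B i (V i w))%:E +
    \int[P]_w (service_prob B i (V i w))%:E.
  rewrite -ge0_integralD//.
  - under eq_integral do rewrite -EFinD subrK.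
    by rewrite integral_cst// mul1e; exact/esym/probability_setT.
  - by move=> w _; rewrite lee_fin subr_ge0; case/andP: (s01 w).
  - by apply/measurable_EFinP; exact: measurable_funB.
  - by move=> w _; rewrite lee_fin; case/andP: (s01 w).
  - exact/measurable_EFinP.
by rewrite addeK// mean_service_prob fin_num_measure//; exact: measurable_RV_le.
Qed.

(** * Means of the counts occurring in one transition *)

Let rate0 i : (0 <= lambda i)%R. Proof. exact: rate_ge0 hsys i. Qed.
Let visit0 i w : (0 <= V i w)%R. Proof. exact: visit_ge0 hsys i w. Qed.
Let switch0 i w : (0 <= D i w)%R. Proof. exact: switch_ge0 hsys i w. Qed.

(** The four kinds of counts are gathered into one finite family, and their laws into a matching
    family of kernels, so that [marginal_law] handles them all. *)
Definition transition_count i (k : bool + ('I_N + 'I_N)) : T -> nat :=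
  match k with
  | inl true => S i
  | inl false => L i
  | inr (inl j) => A1 i j
  | inr (inr j) => A2 i j
  end.

Definition transition_kernel i (k : bool + ('I_N + 'I_N)) (w : T) :
    probability nat R :=
  match k with
  | inl true => binomial_prob (X i i w) (1 - service_prob B i (V i w))%R
  | inl false => poisson_prob (Lambda lambda B i (V i w)) 0%N
  | inr (inl j) => poisson_prob (lambda j * V i w)%R 0%N
  | inr (inr j) => poisson_prob (lambda j * D i w)%R 0%N
  end.

Let survival_itv i w : (0 <= 1 - service_prob B i (V i w) <= 1)%R.
Proof.
have /andP[s0 s1] := service_prob_itv B i (V i w).
by rewrite subr_ge0 s1 gerBl.
Qed.

Let measurable_survival i :
  measurable_fun setT (fun w => 1 - service_prob B i (V i w))%R.
Proof.
apply: measurable_funB => //.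
exact: measurableT_comp (measurable_service_prob _ _) _.
Qed.

Lemma measurable_transition_count i k :
  measurable_fun setT (transition_count i k).
Proof. by case: k => [[]|[j|j]] /=. Qed.

Lemma measurable_transition_kernel i k n :
  measurable_fun setT (fun w => transition_kernel i k w [set n]).
Proof.
case: k => [[]|[j|j]] /=.
- exact: measurable_binomial_prob_set1.
- apply: measurable_poisson_prob_set1.
  exact: measurableT_comp (measurable_Lambda _ (rate0 i)) _.
- by apply: measurable_poisson_prob_set1; exact: measurable_funM.
- by apply: measurable_poisson_prob_set1; exact: measurable_funM.
Qed.

(* A1 i i does not occur in the law of motion, so its law is unspecified. *)
Lemma transition_count_law i k n : k != inr (inl i) ->
  P (transition_count i k @^-1` [set n]) =
  \int[P]_w transition_kernel i k w [set n].
Proof.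
move=> ki; apply: (@marginal_law _ _ _ _ _ _ (transition_kernel i)
    [set k | k != inr (inl i)]%SET).
- exact: measurable_transition_count.
- exact: measurable_transition_kernel.
- move=> a.
  (* Conditioning on the full set leaves the unconditional joint law of the counts. *)
  have := transition_laws hsys i (a (inl true)) (a (inl false))
    (fun j => a (inr (inl j))) (fun j => a (inr (inr j))) measurableT.
  rewrite /= setTI => lawE.
  rewrite (_ : [set w | _] = [set w | [/\ S i w = a (inl true),
      L i w = a (inl false), forall j, j != i -> A1 i j w = a (inr (inl j)) &
      forall j, A2 i j w = a (inr (inr j))]]).
    rewrite lawE; apply: eq_integral => w _.
    rewrite (eq_bigl (fun k => k != inr (inl i))) => [|x]; last by rewrite inE.
    by rewrite !big_sumType/= big_bool/= -!muleA.
  apply/seteqP; split => w /=.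
    move=> Ya; split.
    + by apply: (Ya (inl true)); rewrite inE.
    + by apply: (Ya (inl false)); rewrite inE.
    + by move=> j ji; apply: (Ya (inr (inl j))); rewrite inE.
    + by move=> j; apply: (Ya (inr (inr j))); rewrite inE.
  move=> [Sa La Aa1 Aa2] [[]|[j|j]] //=.
  by rewrite inE => ji; exact: Aa1.
- by rewrite inE.
Qed.

Lemma transition_count_mean i k : k != inr (inl i) ->
  'E_P[fun w => (transition_count i k w)%:R] =
  \int[P]_w \sum_(n <oo) n%:R%:E * transition_kernel i k w [set n].
Proof.
move=> ki; apply: expectation_mixture => //.
- exact: measurable_transition_count.
- exact: measurable_transition_kernel.
- by move=> n; exact: transition_count_law.
Qed.

(** The conditional mean is a function of [X i i] times a function of [V i]; independence of the two
    turns its integral into a product. *)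
Lemma survivors_mean i : 'E_P[fun w => (S i w)%:R] =
  (1 - P [set w | (B i w <= V i w)%R]) * 'E_P[fun w => (X i i w)%:R].
Proof.
have := @transition_count_mean i (inl true) isT => /= ->.
under eq_integral do rewrite binomial_mean//.
pose f (z : nat * R) := (z.1%:R * (1 - service_prob B i z.2))%:E.
have f0 z : 0 <= f z.
  by rewrite lee_fin mulr_ge0// subr_ge0; case/andP: (service_prob_itv B i z.2).
have mf : measurable_fun setT f.
  apply/measurable_EFinP; apply: measurable_funM.
    exact: measurable_natr.
  apply: measurable_funB => //.
  exact: measurableT_comp (measurable_service_prob _ _) _.
have := ge0_integral_indep (@queue_visit_indep i) mf f0.
rewrite /f/= => ->.
under eq_integral => w _.
  under eq_integral do rewrite EFinM.
  rewrite ge0_integralZl//; last 2 first.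
  - exact/measurable_EFinP.
  - by move=> v _; rewrite lee_fin; case/andP: (survival_itv i v).
  rewrite mean_survival_prob.
  over.
rewrite ge0_integralZr//.
- by rewrite muleC unlock.
- by apply/measurable_EFinP/measurable_natr.
- rewrite -mean_survival_prob; apply: integral_ge0 => v _.
  by rewrite lee_fin; case/andP: (survival_itv i v).
Qed.

Lemma new_survivors_mean i :
  'E_P[fun w => (L i w)%:R] = 'E_P[fun w => Lambda lambda B i (V i w)].
Proof.
have := @transition_count_mean i (inl false) isT => /= ->.
rewrite expectation.unlock; apply: eq_integral => w _.
by rewrite poisson_mean// Lambda_ge0.
Qed.

Lemma visit_arrivals_mean i j : j != i ->
  'E_P[fun w => (A1 i j w)%:R] = (lambda j)%:E * 'E_P[V i].
Proof.
move=> ji; have := @transition_count_mean i (inr (inl j)) ji => /= ->.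
rewrite expectation.unlock -ge0_integralZl ?lee_fin//.
- by apply: eq_integral => w _; rewrite poisson_mean ?EFinM// mulr_ge0.
- exact/measurable_EFinP.
- by move=> w _; rewrite lee_fin.
Qed.

Lemma switch_arrivals_mean i j :
  'E_P[fun w => (A2 i j w)%:R] = (lambda j)%:E * 'E_P[D i].
Proof.
have := @transition_count_mean i (inr (inr j)) isT => /= ->.
rewrite expectation.unlock -ge0_integralZl ?lee_fin//.
- by apply: eq_integral => w _; rewrite poisson_mean ?EFinM// mulr_ge0.
- exact/measurable_EFinP.
- by move=> w _; rewrite lee_fin.
Qed.

(** * One-step recursions for the mean queue lengths *)

Lemma next_queue_mean (i j : 'I_N) : 'E_P[fun w => (X (queue hN i.+1) j w)%:R] =
  'E_P[fun w => (tnth (next_queue_lengths X A1 A2 S L i w) j)%:R].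
Proof.
have mnext : measurable_fun setT
    (fun w => tnth (next_queue_lengths X A1 A2 S L i w) j).
  under eq_fun do rewrite tnth_mktuple.
  by case: (j == i); do 2! apply: measurable_fun_addn => //.
(* The law of motion holds in distribution only, so both means are first written through the point
   masses of the coordinate [j]. *)
rewrite !expectation_nat_series//; apply: eq_eseriesr => n _; congr (_ * _).
have mC : measurable [set t : N.-tuple nat | tnth t j = n].
  rewrite -[X in measurable X]setTI.
  by apply: (measurable_tnth j measurableT (Y := [set n])).
rewrite -(law_of_motion hsys i mC); congr (P _).
by apply/seteqP; split => w /=; rewrite tnth_mktuple.
Qed.

Lemma next_other_queue_mean (i j : 'I_N) : j != i ->
  'E_P[fun w => (X (queue hN i.+1) j w)%:R] =
  'E_P[fun w => (X i j w)%:R] + (lambda j)%:E * 'E_P[V i]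
  + (lambda j)%:E * 'E_P[D i].
Proof.
move=> ji; rewrite next_queue_mean.
under eq_fun do rewrite tnth_mktuple (negbTE ji).
rewrite expectation_natD//; last exact: measurable_fun_addn.
by rewrite expectation_natD// visit_arrivals_mean// switch_arrivals_mean.
Qed.

Lemma next_same_queue_mean (i : 'I_N) :
  'E_P[fun w => (X (queue hN i.+1) i w)%:R] =
  (1 - P [set w | (B i w <= V i w)%R]) * 'E_P[fun w => (X i i w)%:R]
  + 'E_P[fun w => Lambda lambda B i (V i w)]
  + (lambda i)%:E * 'E_P[D i].
Proof.
rewrite next_queue_mean.
under eq_fun do rewrite tnth_mktuple eqxx.
rewrite expectation_natD//; last exact: measurable_fun_addn.
rewrite expectation_natD// survivors_mean new_survivors_mean.
by rewrite switch_arrivals_mean.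
Qed.

(** The bound [Lambda t <= lambda t] reduces finiteness to that of the mean visit time; it permits
    cancellation when the cycle is closed. *)
Lemma Lambda_mean_fin_num i :
  'E_P[fun w => Lambda lambda B i (V i w)] \is a fin_num.
Proof.
rewrite unlock ge0_fin_numE; last first.
  by apply: integral_ge0 => w _; rewrite lee_fin Lambda_ge0.
apply: (@le_lt_trans _ _ ((lambda i)%:E * 'E_P[V i])); last first.
  rewrite lte_mul_pinfty ?lee_fin// ?expectation_ge0//.
  exact: visit_mean_fin hsys i.
rewrite expectation.unlock -ge0_integralZl ?lee_fin//; last 2 first.
- exact/measurable_EFinP.
- by move=> w _; rewrite lee_fin.
apply: ge0_le_integral => //.
- by move=> w _; rewrite lee_fin Lambda_ge0.
- apply/measurable_EFinP.
  exact: measurableT_comp (measurable_Lambda _ (rate0 i)) _.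
- by apply/measurable_EFinP; exact: measurable_funM.
- by move=> w _; rewrite lee_fin Lambda_le.
Qed.

End polling_means.

(** * Cyclic indices and sums over one cycle *)

Section cyclic_indices.
Context (N : nat) (hN : (1 < N)%N).

Lemma queue_ord (i : 'I_N) : queue hN i = i.
Proof. by apply: val_inj => /=; rewrite modn_small. Qed.

Lemma queue_addN k : queue hN (k + N) = queue hN k.
Proof. by apply: val_inj => /=; rewrite modnDr. Qed.

Lemma queueS k : queue hN (queue hN k).+1 = queue hN k.+1.
Proof. by apply: val_inj => /=; rewrite -[in LHS]addn1 modnDml addn1. Qed.

(** Since [k < 2N], its residue is [k] or [k - N]: the former exceeds [j], the latter lies below
    it. *)
Lemma queue_neq (j : 'I_N) k : (j < k < j + N)%N -> queue hN k != j.
Proof.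
move=> /andP[jk kjN]; apply: contraTneq jk => /(congr1 val)/= kj.
rewrite -leqNgt -kj; have [kN|Nk] := ltnP k N; first by rewrite modn_small.
have : (k - N < j)%N by rewrite ltn_subLR// addnC.
rewrite -kj -{2}(subnK Nk) modnDr modn_small ?ltnn//.
by rewrite ltn_subLR// (leq_trans kjN)// leq_add2r ltnW.
Qed.

(** Shifting the window by one drops [j] and adds [j + N], which is the same queue. *)
Lemma sum_cycle (R : realType) (F : 'I_N -> \bar R) j :
  \sum_(j <= k < j + N) F (queue hN k) = \sum_(i < N) F i.
Proof.
elim: j => [|j IHj].
  rewrite add0n big_mkord; apply: eq_bigr => i _.
  by rewrite queue_ord.
rewrite -IHj addSn big_nat_recr/=; last by rewrite -addn1 leq_add2l ltnW.
rewrite [in RHS]big_ltn; last by rewrite -addn1 leq_add2l ltnW.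
by rewrite queue_addN addeC.
Qed.

Lemma sum_cycle_neq (R : realType) (F : 'I_N -> \bar R) (j : 'I_N) :
  \sum_(j.+1 <= k < j + N) F (queue hN k) = \sum_(i < N | i != j) F i.
Proof.
rewrite [RHS]big_mkcond/= -(sum_cycle _ j).
rewrite [in RHS]big_ltn; last by rewrite -addn1 leq_add2l ltnW.
rewrite queue_ord eqxx add0e; apply: eq_big_nat => k jkN.
by rewrite queue_neq.
Qed.

End cyclic_indices.

(** * Iteration of the recursions over one cycle *)

Theorem mainTheorem4 (R : realType) (d : measure_display)
    (T : measurableType d) (P : probability T R) (N : nat) (hN : (1 < N)%N)
    (lambda : 'I_N -> R) (V D B : 'I_N -> {RV P >-> R})
    (X A1 A2 : 'I_N -> 'I_N -> {RV P >-> nat})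
    (S L : 'I_N -> {RV P >-> nat})
    (hsys : steady_state_polling hN lambda V D B X A1 A2 S L)
    (j : 'I_N) :
  let p := P [set w | (B j w <= V j w)%R] in
  p * 'E_P[fun w => (X j j w)%:R] =
    (lambda j)%:E * (\sum_(i < N | i != j) 'E_P[V i])
    + 'E_P[fun w => Lambda lambda B j (V j w)]
    + (lambda j)%:E * 'E_P[fun w => (\sum_(i < N) D i w)%R]
  /\
  forall i : nat, (j < i < j + N)%N ->
    'E_P[fun w => (X (queue hN i) j w)%:R] =
      (1 - p) * 'E_P[fun w => (X j j w)%:R]
      + 'E_P[fun w => Lambda lambda B j (V j w)]
      + (lambda j)%:E * (\sum_(j.+1 <= k < i) 'E_P[V (queue hN k)])
      + (lambda j)%:E * (\sum_(j <= k < i) 'E_P[D (queue hN k)]).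
Proof.
move=> p.
(* Nonnegativity allows [lambda j] to be distributed over sums in the extended reals. *)
have V0 i : 0 <= 'E_P[V i] by apply/expectation_ge0/(visit_ge0 hsys).
have D0 i : 0 <= 'E_P[D i] by apply/expectation_ge0/(switch_ge0 hsys).
have jN : (j.+1 <= j + N)%N by rewrite -addn1 leq_add2l ltnW.
(* The endpoint [i = j + N] is included: there the servers are back at [j], which yields the first
   formula. *)
have cycle i : (j < i <= j + N)%N ->
    'E_P[fun w => (X (queue hN i) j w)%:R] =
      (1 - p) * 'E_P[fun w => (X j j w)%:R]
      + 'E_P[fun w => Lambda lambda B j (V j w)]
      + (lambda j)%:E * (\sum_(j.+1 <= k < i) 'E_P[V (queue hN k)])
      + (lambda j)%:E * (\sum_(j <= k < i) 'E_P[D (queue hN k)]).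
  elim: i => [//|i IHi]; rewrite ltnS => /andP[ji iN].
  (* Base case: the servers have just left [j], so the sum of visit times is empty and only the
     switch-over after [j] counts. *)
  move: ji; rewrite leq_eqVlt => /predU1P[<-|ji].
    rewrite (next_same_queue_mean hsys) big_geq// mule0 adde0.
    by rewrite big_nat1 queue_ord.
  rewrite -queueS (next_other_queue_mean hsys); last first.
    by rewrite eq_sym queue_neq// ji.
  rewrite IHi ?ji ?(ltnW iN)//.
  rewrite [in RHS]big_nat_recr//= ge0_muleDr ?sume_ge0//.
  rewrite [in RHS]big_nat_recr ?(ltnW ji)//= ge0_muleDr ?sume_ge0//.
  by rewrite -!addeA; congr (_ + (_ + (_ + _))); rewrite addeCA.
split; last by move=> i /andP[ji iN]; apply: cycle; rewrite ji ltnW.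
have Vfin i : 'E_P[V i] \is a fin_num.
  by rewrite ge0_fin_numE//; exact: visit_mean_fin hsys i.
have Dfin i : 'E_P[D i] \is a fin_num.
  by rewrite ge0_fin_numE//; exact: switch_mean_fin hsys i.
have Xfin : 'E_P[fun w => (X j j w)%:R] \is a fin_num.
  rewrite ge0_fin_numE; first exact: (queue_mean_fin hsys).
  exact: expectation_ge0.
have Lfin := Lambda_mean_fin_num hsys j.
have pfin : p \is a fin_num.
  by apply: fin_num_measure; exact: measurable_RV_le.
have -> : 'E_P[fun w => (\sum_(i < N) D i w)%R] = \sum_(i < N) 'E_P[D i].
  rewrite expectation.unlock -ge0_integral_sum//.
  - by apply: eq_integral => w _; rewrite sumEFin.
  - by move=> i; exact/measurable_EFinP.
  - by move=> i w _; rewrite lee_fin; exact: switch_ge0 hsys i w.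
have SVfin : \sum_(i < N | i != j) 'E_P[V i] \is a fin_num.
  by apply/sum_fin_numP => i _ _.
have SDfin : \sum_(i < N) 'E_P[D i] \is a fin_num.
  by apply/sum_fin_numP => i _ _.
(* At [j + N] the left side is again the mean of [X j j]; the visits are those to all other queues,
   the switch-overs those of the whole cycle. *)
have := cycle (j + N)%N; rewrite leqnn andbT => /(_ jN).
rewrite queue_addN queue_ord (sum_cycle_neq hN (fun i => 'E_P[V i])).
rewrite (sum_cycle hN (fun i => 'E_P[D i])).
(* All terms are finite, so the balance equation passes to the reals, where the mean of [X j j] can
   be subtracted. *)
rewrite -(fineK Xfin) -(fineK Lfin) -(fineK pfin) -(fineK SVfin) -(fineK SDfin).
rewrite -!EFinM -!EFinD => -[e]; congr EFin.
by lra.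
Qed.
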